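(* Let $\mathcal{Q}$ be a small quantaloid and let $\mathcal{D}(\mathcal{Q})$ be the quantaloid of diagonals in $\mathcal{Q}$. Then $\mathcal{Q}$ is divisible if and only if $\mathcal{D}(\mathcal{Q})$ is divisible.
   Context: A quantaloid $\mathcal{Q}$ is a category in which every hom-set $\mathcal{Q}(A,B)$ is a complete lattice and composition distributes over arbitrary suprema in both variables. For $f\colon A\to B$, the right adjoint of $-\circ f\colon\mathcal{Q}(B,X)\to\mathcal{Q}(A,X)$ is written $-\swarrow f\colon\mathcal{Q}(A,X)\to\mathcal{Q}(B,X)$, and the right adjoint of $f\circ-\colon\mathcal{Q}(X,A)\to\mathcal{Q}(X,B)$ is written $f\searrow-\colon\mathcal{Q}(X,B)\to\mathcal{Q}(X,A)$. Divisibility: a quantaloid $\mathcal{Q}$ is divisible if for all parallel morphisms $d,e\colon A\to B$ in $\mathcal{Q}$: $d\le e$ if and only if $e\circ(e\searrow d)=d=(d\swarrow e)\circ e$. (Equivalently: for all $d,e\colon A\to B$, $d\le e$ iff there exist $x\colon A\to A$ and $y\colon B\to B$ with $e\circ x=d=y\circ e$. Equivalently: for all $d,e\colon A\to B$, $e\circ(e\searrow d)=d\wedge e=(d\swarrow e)\circ e$.) Diagonals: given $f\colon A\to B$ and $g\colon C\to D$ in $\mathcal{Q}$, a morphism $d\colon A\to D$ is a diagonal from $f$ to $g$ if there exist $x\colon A\to C$ and $y\colon B\to D$ with $y\circ f=d=g\circ x$; equivalently, $g\circ(g\searrow d)=d=(d\swarrow f)\circ f$. The quantaloid $\mathcal{D}(\mathcal{Q})$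 has as objects the morphisms of $\mathcal{Q}$; morphisms $f\to g$ are the diagonals from $f$ to $g$; the composite of $d\colon f\to g$ and $e\colon g\to h$ is $e\circ_g d:=(e\swarrow g)\circ g\circ(g\searrow d)$; the identity on $f$ is $f$ itself; and suprema of diagonals (hence also the order) are computed as in $\mathcal{Q}$. *)

(* Defs.v *)
From Stdlib Require Import Relation_Definitions ProofIrrelevance.

Set Implicit Arguments.
Unset Strict Implicit.
Unset Printing Implicit Defensive.

Declare Scope quantaloid_scope.
Delimit Scope quantaloid_scope with quantaloid.

(* Suprema are taken over arbitrary predicates, the empty one included, so each
   hom-set is a complete lattice.  Smallness is the requirement that the
   objects, as well as each hom-set, form a type. *)
Record quantaloid : Type := Quantaloid {
  ob : Type;
  hom : ob -> ob -> Type;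
  idm : forall A : ob, hom A A;
  comp : forall A B C : ob, hom B C -> hom A B -> hom A C;
  compA : forall (A B C D : ob) (h : hom C D) (g : hom B C) (f : hom A B),
    comp h (comp g f) = comp (comp h g) f;
  comp1m : forall (A B : ob) (f : hom A B), comp (idm B) f = f;
  compm1 : forall (A B : ob) (f : hom A B), comp f (idm A) = f;
  qle : forall A B : ob, relation (hom A B);
  qle_order : forall A B : ob, order (hom A B) (@qle A B);
  qsup : forall A B : ob, (hom A B -> Prop) -> hom A B;
  qsup_ub : forall (A B : ob) (S : hom A B -> Prop) (f : hom A B),
    S f -> qle f (qsup S);
  qsup_least : forall (A B : ob) (S : hom A B -> Prop) (u : hom A B),
    (forall f, S f -> qle f u) -> qle (qsup S) u;
  comp_supl : forall (A B C : ob) (S : hom B C -> Prop) (f : hom A B),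
    comp (qsup S) f = qsup (fun k => exists2 g, S g & k = comp g f);
  comp_supr : forall (A B C : ob) (g : hom B C) (S : hom A B -> Prop),
    comp g (qsup S) = qsup (fun k => exists2 f, S f & k = comp g f)
}.

Arguments hom {q} A B.
Arguments idm {q} A.
Arguments comp {q A B C} g f : rename.
Arguments qle {q A B} f g : rename.
Arguments qsup {q A B} S : rename.

Notation "g ∘ f" := (comp g f)
  (at level 40, left associativity) : quantaloid_scope.
Notation "f ≤ g" := (qle f g)
  (at level 70, no associativity) : quantaloid_scope.
Local Open Scope quantaloid_scope.

(* Residuals are given by the usual supremum formula; lres_adj and rres_adj show
   that they are the right adjoints of pre- and post-composition. *)
Definition lres {Q : quantaloid} {A B X : ob Q} (d : hom A X) (f : hom A B) :
    hom B X :=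
  qsup (fun g => g ∘ f ≤ d).

Definition rres {Q : quantaloid} {A B X : ob Q} (f : hom A B) (d : hom X B) :
    hom X A :=
  qsup (fun g => f ∘ g ≤ d).

Notation "d ↙ f" := (lres d f)
  (at level 35, no associativity) : quantaloid_scope.
Notation "f ↘ d" := (rres f d)
  (at level 35, no associativity) : quantaloid_scope.

Definition divisible (Q : quantaloid) : Prop :=
  forall (A B : ob Q) (d e : hom A B),
    d ≤ e <-> (e ∘ (e ↘ d) = d /\ d = (d ↙ e) ∘ e).

Section QuantaloidTheory.
Variable Q : quantaloid.
Implicit Types A B C X : ob Q.

Lemma qle_refl A B (f : hom A B) : f ≤ f.
Proof. apply (ord_refl _ _ (qle_order A B)). Qed.

Lemma qle_trans A B (f g h : hom A B) : f ≤ g -> g ≤ h -> f ≤ h.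
Proof. apply (ord_trans _ _ (qle_order A B)). Qed.

Lemma qle_anti A B (f g : hom A B) : f ≤ g -> g ≤ f -> f = g.
Proof. apply (ord_antisym _ _ (qle_order A B)). Qed.

Lemma qsup_pair A B (f g : hom A B) :
  f ≤ g -> qsup (fun k => k = f \/ k = g) = g.
Proof.
intros H; apply qle_anti.
- apply qsup_least; intros k [-> | ->]; [exact H | apply qle_refl].
- apply qsup_ub; now right.
Qed.

Lemma comp_monol A B C (g g' : hom B C) (f : hom A B) :
  g ≤ g' -> g ∘ f ≤ g' ∘ f.
Proof.
intros H; rewrite <- (qsup_pair H), comp_supl.
apply qsup_ub; exists g; auto.
Qed.

Lemma comp_monor A B C (g : hom B C) (f f' : hom A B) :
  f ≤ f' -> g ∘ f ≤ g ∘ f'.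
Proof.
intros H; rewrite <- (qsup_pair H), comp_supr.
apply qsup_ub; exists f; auto.
Qed.

Lemma lres_counit A B X (d : hom A X) (f : hom A B) : (d ↙ f) ∘ f ≤ d.
Proof.
unfold lres; rewrite comp_supl.
apply qsup_least; intros k [g Hg ->]; exact Hg.
Qed.

Lemma rres_counit A B X (f : hom A B) (d : hom X B) : f ∘ (f ↘ d) ≤ d.
Proof.
unfold rres; rewrite comp_supr.
apply qsup_least; intros k [g Hg ->]; exact Hg.
Qed.

Lemma lres_adj A B X (g : hom B X) (f : hom A B) (d : hom A X) :
  g ∘ f ≤ d <-> g ≤ d ↙ f.
Proof.
split; intros H.
- apply qsup_ub; exact H.
- apply (qle_trans (comp_monol f H)), lres_counit.
Qed.

Lemma rres_adj A B X (f : hom A B) (g : hom X A) (d : hom X B) :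
  f ∘ g ≤ d <-> g ≤ f ↘ d.
Proof.
split; intros H.
- apply qsup_ub; exact H.
- apply (qle_trans (comp_monor f H)), rres_counit.
Qed.

End QuantaloidTheory.

Record arrow (Q : quantaloid) : Type := Arrow {
  src : ob Q;
  tgt : ob Q;
  arr :> hom src tgt
}.

Definition is_diagonal (Q : quantaloid) (f g : arrow Q)
    (d : hom (src f) (tgt g)) : Prop :=
  exists (x : hom (src f) (src g)) (y : hom (tgt f) (tgt g)),
    y ∘ f = d /\ d = g ∘ x.

Record diagonal (Q : quantaloid) (f g : arrow Q) : Type := Diagonal {
  diag :> hom (src f) (tgt g);
  diagP : is_diagonal diag
}.

Section DiagonalTheory.
Variable Q : quantaloid.
Implicit Types f g h k : arrow Q.

Lemma is_diagonalE f g (d : hom (src f) (tgt g)) :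
  is_diagonal d <-> g ∘ (g ↘ d) = d /\ d = (d ↙ f) ∘ f.
Proof.
split.
- intros (x & y & Hy & Hx); split; apply qle_anti.
  + apply rres_counit.
  + rewrite Hx; apply comp_monor, rres_adj, qle_refl.
  + rewrite <- Hy; apply comp_monol, lres_adj, qle_refl.
  + apply lres_counit.
- intros [H1 H2]; exists (g ↘ d), (d ↙ f); now split.
Qed.

Lemma diagonal_eq f g (d e : diagonal f g) : diag d = diag e -> d = e.
Proof.
destruct d as [d dP], e as [e eP]; simpl; intros E; destruct E.
f_equal; apply proof_irrelevance.
Qed.

Lemma diag_r f g (d : diagonal f g) : g ∘ (g ↘ d) = d.
Proof. now apply is_diagonalE, diagP. Qed.

Lemma diag_l f g (d : diagonal f g) : (d ↙ f) ∘ f = d.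
Proof. symmetry; now apply is_diagonalE, diagP. Qed.

Lemma diag_idP f : @is_diagonal Q f f f.
Proof. exists (idm _), (idm _); now rewrite comp1m, compm1. Qed.

Definition diag_id f : diagonal f f := Diagonal (diag_idP f).

Lemma diag_compP f g h (e : diagonal g h) (d : diagonal f g) :
  is_diagonal ((e ↙ g) ∘ g ∘ (g ↘ d)).
Proof.
exists ((h ↘ e) ∘ (g ↘ d)), ((e ↙ g) ∘ (d ↙ f)); split.
- now rewrite <- compA, diag_l, <- compA, diag_r.
- now rewrite compA, diag_r, diag_l.
Qed.

Definition diag_comp f g h (e : diagonal g h) (d : diagonal f g) :
    diagonal f h :=
  Diagonal (diag_compP e d).

Lemma diag_compEl f g h (e : diagonal g h) (d : diagonal f g) :
  diag (diag_comp e d) = (e ↙ g) ∘ d.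
Proof. now simpl; rewrite <- compA, diag_r. Qed.

Lemma diag_compEr f g h (e : diagonal g h) (d : diagonal f g) :
  diag (diag_comp e d) = e ∘ (g ↘ d).
Proof. now simpl; rewrite diag_l. Qed.

Lemma diag_compA f g h k (c : diagonal h k) (e : diagonal g h)
    (d : diagonal f g) :
  diag_comp c (diag_comp e d) = diag_comp (diag_comp c e) d.
Proof.
apply diagonal_eq.
now rewrite diag_compEl, (diag_compEr e d), (diag_compEr _ d), diag_compEl,
  compA.
Qed.

Lemma diag_comp1m f g (d : diagonal f g) : diag_comp (diag_id g) d = d.
Proof. now apply diagonal_eq; rewrite diag_compEr; simpl; rewrite diag_r. Qed.

Lemma diag_compm1 f g (d : diagonal f g) : diag_comp d (diag_id f) = d.
Proof. now apply diagonal_eq; rewrite diag_compEl; simpl; rewrite diag_l. Qed.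

Definition diag_le f g (d e : diagonal f g) : Prop := diag d ≤ diag e.

Lemma diag_le_order f g : order (diagonal f g) (@diag_le f g).
Proof.
split.
- intros d; apply qle_refl.
- intros d e c; apply qle_trans.
- intros d e H1 H2; apply diagonal_eq, qle_anti; assumption.
Qed.

(* Suprema of diagonals are those of Q, taken of the underlying morphisms. *)
Definition diag_image f g (S : diagonal f g -> Prop) :
    hom (src f) (tgt g) -> Prop :=
  fun u => exists2 d, S d & u = diag d.

Lemma diag_supP f g (S : diagonal f g -> Prop) :
  is_diagonal (qsup (diag_image S)).
Proof.
apply is_diagonalE; split; apply qle_anti.
- apply rres_counit.
- apply qsup_least; intros u [d Sd ->].
  rewrite <- (diag_r d); apply comp_monor, rres_adj.
  rewrite diag_r; apply qsup_ub; exists d; auto.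
- apply qsup_least; intros u [d Sd ->].
  rewrite <- (diag_l d); apply comp_monol, lres_adj.
  rewrite diag_l; apply qsup_ub; exists d; auto.
- apply lres_counit.
Qed.

Definition diag_sup f g (S : diagonal f g -> Prop) : diagonal f g :=
  Diagonal (diag_supP S).

Lemma diag_sup_ub f g (S : diagonal f g -> Prop) (d : diagonal f g) :
  S d -> diag_le d (diag_sup S).
Proof. intros Sd; apply qsup_ub; exists d; auto. Qed.

Lemma diag_sup_least f g (S : diagonal f g -> Prop) (u : diagonal f g) :
  (forall d, S d -> diag_le d u) -> diag_le (diag_sup S) u.
Proof. intros H; apply qsup_least; intros v [d Sd ->]; now apply H. Qed.

Lemma diag_comp_supl f g h (S : diagonal g h -> Prop) (d : diagonal f g) :
  diag_comp (diag_sup S) d =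
  diag_sup (fun c => exists2 e, S e & c = diag_comp e d).
Proof.
apply diagonal_eq; rewrite diag_compEr; simpl; rewrite comp_supl.
apply qle_anti; apply qsup_least.
- intros u [v [e Se ->] ->]; apply qsup_ub.
  exists (diag_comp e d); [now exists e | now rewrite diag_compEr].
- intros u [v [e Se ->] ->]; rewrite diag_compEr; apply qsup_ub.
  exists (diag e); [now exists e | reflexivity].
Qed.

Lemma diag_comp_supr f g h (e : diagonal g h) (S : diagonal f g -> Prop) :
  diag_comp e (diag_sup S) =
  diag_sup (fun c => exists2 d, S d & c = diag_comp e d).
Proof.
apply diagonal_eq; rewrite diag_compEl; simpl; rewrite comp_supr.
apply qle_anti; apply qsup_least.
- intros u [v [d Sd ->] ->]; apply qsup_ub.
  exists (diag_comp e d); [now exists d | now rewrite diag_compEl].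
- intros u [v [d Sd ->] ->]; rewrite diag_compEl; apply qsup_ub.
  exists (diag d); [now exists d | reflexivity].
Qed.

End DiagonalTheory.

Definition diagonals (Q : quantaloid) : quantaloid :=
  Quantaloid (@diag_compA Q) (@diag_comp1m Q) (@diag_compm1 Q)
    (@diag_le_order Q) (@diag_sup_ub Q) (@diag_sup_least Q)
    (@diag_comp_supl Q) (@diag_comp_supr Q).

(* Main.v *)
From Stdlib Require Import Setoid.
Require Import Defs.

(** Divisibility of Q says that, on parallel morphisms, d ≤ e holds exactly when
    d factors through e on both sides, i.e. when d is a diagonal from e to
    itself ([divisibleE]).  In this form both implications are about moving
    factorisations between Q and D(Q).

    From Q to D(Q): every x : A → A factors through the identity on both sides,
    so divisibility forces x ≤ 1 ([divisible_integral]).  Let d ≤ e be diagonals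
    from f to g, and write d = e ∘ x = y ∘ e in Q.  By integrality f ∘ x ≤ f and
    y ∘ g ≤ g, so by divisibility these are diagonals from f to f and from g to
    g.  They factor d through e in D(Q), because the composite of e with f ∘ x
    is (e ↙ f) ∘ f ∘ x = e ∘ x, and dually.  Conversely a composite of e with a
    diagonal from f to f is e ∘ p for some p, which integrality puts below e.

    From D(Q) to Q: the assignment A ↦ 1_A embeds Q into D(Q), fully, faithfully
    and preserving and reflecting order ([diag_of_hom], [diag_comp_idm]), and
    divisibility passes to full subcategories. *)

Local Open Scope quantaloid_scope.

(** This trades the residuals for existentially quantified factors, which are
    easier to transport between Q and D(Q). *)
Lemma divisibleE (Q : quantaloid) :
  divisible Q <->
  forall (A B : ob Q) (d e : hom A B),
    d ≤ e <-> is_diagonal (f := Arrow e) (g := Arrow e) d.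
Proof.
split; intros H A B d e.
- apply (iff_trans (H A B d e)), iff_sym.
  apply (is_diagonalE (f := Arrow e) (g := Arrow e)).
- apply (iff_trans (H A B d e)).
  apply (is_diagonalE (f := Arrow e) (g := Arrow e)).
Qed.

Lemma divisible_integral (Q : quantaloid) (A : ob Q) (x : hom A A) :
  divisible Q -> x ≤ idm A.
Proof.
intros H; apply (proj1 (divisibleE Q) H).
exists x, x; simpl; now rewrite comp1m, compm1.
Qed.

Lemma divisible_diagonals (Q : quantaloid) :
  divisible Q -> divisible (diagonals Q).
Proof.
intros H; apply divisibleE.
intros f g d e; change (diagonal f g) in d, e; split.
- intros Hde.
  destruct (proj1 (proj1 (divisibleE Q) H _ _ (diag d) (diag e)) Hde)
    as (x & y & Hy & Hx); simpl in x, y, Hx, Hy.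
  assert (Px : is_diagonal (f := f) (g := f) (f ∘ x)).
  { apply (proj1 (divisibleE Q) H _ _ (f ∘ x) f).
    rewrite <- (compm1 (arr f)) at 2.
    apply comp_monor, divisible_integral, H. }
  assert (Py : is_diagonal (f := g) (g := g) (y ∘ g)).
  { apply (proj1 (divisibleE Q) H _ _ (y ∘ g) g).
    rewrite <- (comp1m (arr g)) at 2.
    apply comp_monol, divisible_integral, H. }
  exists (Diagonal Px), (Diagonal Py); split; apply diagonal_eq.
  + change (diag (diag_comp (Diagonal Py) e) = diag d).
    now rewrite diag_compEr; simpl; rewrite <- compA, diag_r.
  + change (diag d = diag (diag_comp e (Diagonal Px))).
    now rewrite diag_compEl; simpl; rewrite compA, diag_l.
- intros (x & y & _ & Hx); rewrite Hx.
  change (diag (diag_comp e x) ≤ diag e); rewrite diag_compEr.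
  rewrite <- (compm1 (diag e)) at 2.
  apply comp_monor, divisible_integral, H.
Qed.

Lemma is_diagonal_idm (Q : quantaloid) (A B : ob Q) (d : hom A B) :
  is_diagonal (f := Arrow (idm A)) (g := Arrow (idm B)) d.
Proof. exists d, d; simpl; now rewrite comp1m, compm1. Qed.

Definition diag_of_hom (Q : quantaloid) (A B : ob Q) (d : hom A B) :
    diagonal (Arrow (idm A)) (Arrow (idm B)) :=
  Diagonal (is_diagonal_idm Q A B d).

(** Functoriality of the embedding A ↦ 1_A, stated for arbitrary diagonals
    since each of them is in its image. *)
Lemma diag_comp_idm (Q : quantaloid) (A B C : ob Q)
    (e : diagonal (Arrow (idm B)) (Arrow (idm C)))
    (d : diagonal (Arrow (idm A)) (Arrow (idm B))) :
  diag (diag_comp e d) = diag e ∘ diag d.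
Proof.
rewrite diag_compEl; f_equal.
rewrite <- (diag_l e) at 2; simpl; now rewrite compm1.
Qed.

Lemma divisible_of_diagonals (Q : quantaloid) :
  divisible (diagonals Q) -> divisible Q.
Proof.
intros H; apply divisibleE; intros A B d e.
pose proof (proj1 (divisibleE (diagonals Q)) H _ _
  (diag_of_hom Q A B d) (diag_of_hom Q A B e)) as Hde.
apply (iff_trans Hde); split; intros (x & y & Hy & Hx); simpl in x, y, Hx, Hy.
- exists (diag x), (diag y); split.
  + apply (f_equal (fun c => diag c)) in Hy.
    now rewrite diag_comp_idm in Hy.
  + apply (f_equal (fun c => diag c)) in Hx.
    now rewrite diag_comp_idm in Hx.
- exists (diag_of_hom Q A A x), (diag_of_hom Q B B y).
  split; apply diagonal_eq.
  + change (diag (diag_comp (diag_of_hom Q B B y) (diag_of_hom Q A B e)) = d).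
    now rewrite diag_comp_idm.
  + change (d = diag (diag_comp (diag_of_hom Q A B e) (diag_of_hom Q A A x))).
    now rewrite diag_comp_idm.
Qed.

Theorem proposition3p2p4 (Q : quantaloid) :
  divisible Q <-> divisible (diagonals Q).
Proof.
split; [apply divisible_diagonals | apply divisible_of_diagonals].
Qed.
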